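(* Let $\mathbb{F}$ be a field, let $C\subseteq \mathbb{F}^n$ be a linear code of length $n$, and let $G$ be a finite group of order $n$. (1) $C$ is a left $G$-code if and only if $G$ is isomorphic to a transitive subgroup of $S_n$ contained in $\mathrm{PAut}(C)$. (2) $C$ is a $G$-code if and only if $G$ is isomorphic to a transitive subgroup $H$ of $S_n$ such that $H\cup C_{S_n}(H)\subseteq \mathrm{PAut}(C)$.
   Context: The field $\mathbb{F}$ need not be finite. A linear code of length $n$ over $\mathbb{F}$ is a linear subspace of $\mathbb{F}^n$; $E=\{e_1,\dots,e_n\}$ is the standard basis of $\mathbb{F}^n$. $S_n$ is the group of permutations of $\{1,\dots,n\}$, acting linearly on $\mathbb{F}^n$ by $\sigma(e_i)=e_{\sigma(i)}$. The group of permutation automorphisms of $C$ is $\mathrm{PAut}(C)=\{\sigma\in S_n:\sigma(C)=C\}$. $C_{S_n}(H)$ is the centralizer of $H$ in $S_n$. For a group $G$ of order $n$, $C$ is a left $G$-code (respectively, a $G$-code) if there is a bijection $\phi:E\to G$ whose linear extension $\phi:\mathbb{F}^n\to\mathbb{F}G$ to the group algebra maps $C$ onto a left ideal (respectively, a two-sided ideal) of $\mathbb{F}G$. *)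

(* Defs.v *)
From HB Require Import structures.
From mathcomp Require Import all_boot all_order all_algebra.
From mathcomp Require Import all_fingroup all_solvable all_field all_character.

Set Implicit Arguments.
Unset Strict Implicit.
Unset Printing Implicit Defensive.

Import GRing.Theory GroupScope.
Local Open Scope ring_scope.

Section PermutationAutomorphisms.

Variables (F : fieldType) (n : nat).

Definition perm_lfun (s : 'S_n) : 'End('rV[F]_n) :=
  linfun (mulmxr (perm_mx s)).

Lemma perm_lfun_delta (s : 'S_n) (i : 'I_n) :
  perm_lfun s (delta_mx 0 i) = delta_mx 0 (s i).
Proof.
by rewrite lfunE /= -rowE; apply/rowP=> j; rewrite !mxE eqxx eq_sym.
Qed.

Definition PAut (C : {vspace 'rV[F]_n}) : {set 'S_n} :=
  [set s | (perm_lfun s @: C)%VS == C].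

End PermutationAutomorphisms.

(* The group algebra FG is the library's group_ring F G, i.e. the row space of
   matrices spanned by the (linearly independent) images of the elements of G
   in the regular representation, in which g : G is regular_repr F G g. *)
Section GroupCodes.

Variables (F : fieldType) (n : nat) (gT : finGroupType) (G : {group gT}).

Definition lin_ext (phi : 'I_n -> gT) (v : 'rV[F]_n) : 'M[F]_#|G| :=
  \sum_(i < n) v 0 i *: regular_repr F G (phi i).

Lemma lin_ext_delta (phi : 'I_n -> gT) (i : 'I_n) :
  lin_ext phi (delta_mx 0 i) = regular_repr F G (phi i).
Proof.
rewrite /lin_ext (bigD1 i) //= big1 => [|j ne_ji].
  by rewrite mxE !eqxx scale1r addr0.
by rewrite mxE (negPf ne_ji) andbF scale0r.
Qed.

(* The basis E is indexed by 'I_n, so that phi i stands for phi(e_i). *)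
Definition basis_bij (phi : 'I_n -> gT) : Prop :=
  injective phi /\ [set phi i | i : 'I_n] = G.

(* The row space of I is the image of C; every subspace of 'M[F]_#|G| is the
   row space of some matrix with #|G| ^ 2 rows. *)
Definition maps_onto (phi : 'I_n -> gT) (C : {vspace 'rV[F]_n})
    (I : 'A[F]_#|G|) : Prop :=
  forall A : 'M[F]_#|G|,
    (A \in I)%MS <-> exists2 v, v \in C & A = lin_ext phi v.

Definition left_group_code (C : {vspace 'rV[F]_n}) : Prop :=
  exists phi : 'I_n -> gT, basis_bij phi /\
  exists I : 'A[F]_#|G|,
    [/\ (I <= group_ring F G)%MS, left_mx_ideal (group_ring F G) I
      & maps_onto phi C I].

Definition group_code (C : {vspace 'rV[F]_n}) : Prop :=
  exists phi : 'I_n -> gT, basis_bij phi /\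
  exists I : 'A[F]_#|G|,
    [/\ (I <= group_ring F G)%MS, mx_ideal (group_ring F G) I
      & maps_onto phi C I].

End GroupCodes.

(* Main.v *)
Require Import Defs.
From HB Require Import structures.
From mathcomp Require Import all_boot all_order all_algebra.
From mathcomp Require Import all_fingroup all_solvable all_field all_character.

Set Implicit Arguments.
Unset Strict Implicit.
Unset Printing Implicit Defensive.

Import GRing.Theory GroupScope.
Local Open Scope ring_scope.

(* A bijection phi between {1, ..., n} and G transports left and right
   multiplications by elements of G to permutations in S_n, and C is carried to
   a left (right) ideal iff these left (right) translations preserve C.  The
   left translations form a regular group isomorphic to G, whose centralizer is
   the set of right translations.  Conversely a transitive subgroup isomorphic
   to G is regular because |G| = n, so the orbit map of a point identifies it
   with the group of left translations for a suitable phi. *)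

(** * Permutation automorphisms as stabilizers of a code *)

Lemma perm_lfun_inj (F : fieldType) (n : nat) (s : 'S_n) :
  injective (perm_lfun F s).
Proof.
have sK : cancel (mulmxr (perm_mx s) : 'rV[F]_n -> _) (mulmxr (perm_mx s^-1)).
  by move=> w /=; rewrite -mulmxA -perm_mxM mulgV perm_mx1 mulmx1.
by move=> u v; rewrite !lfunE /=; apply: (can_inj sK).
Qed.

(** Inclusion is enough: [perm_lfun F s] is injective, so the image of [C] has the dimension of
    [C]. *)
Lemma PAutP (F : fieldType) (n : nat) (C : {vspace 'rV[F]_n}) (s : 'S_n) :
  reflect (forall v, v \in C -> perm_lfun F s v \in C) (s \in PAut C).
Proof.
rewrite inE; apply: (iffP eqP) => [eqC v Cv | stC]; first by rewrite -eqC memv_img.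
have /eqP ker0 : lker (perm_lfun F s) == 0%VS by apply/lker0P/perm_lfun_inj.
apply/eqP; rewrite eqEdim limg_dim_eq ?ker0 ?capv0 // leqnn andbT.
by apply/subvP=> _ /memv_imgP[v Cv ->]; apply: stC.
Qed.

(** * Translations of G as permutations of the coordinates *)

Section Translations.

Variables (n : nat) (gT : finGroupType) (G : {group gT}) (phi : 'I_n -> gT).

Definition left_translations : {set 'S_n} :=
  [set s : 'S_n | [exists g in G, forall i, phi (s i) == (g * phi i)%g]].

Definition right_translations : {set 'S_n} :=
  [set s : 'S_n | [exists g in G, forall i, phi (s i) == (phi i * g)%g]].

Lemma left_translationsP (s : 'S_n) :
  reflect (exists2 g, g \in G & forall i, phi (s i) = (g * phi i)%g)
          (s \in left_translations).
Proof.
rewrite inE; apply: (iffP exists_inP) => -[g Gg].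
  by move/forallP=> sg; exists g => // i; apply/eqP.
by move=> sg; exists g => //; apply/forallP=> i; apply/eqP.
Qed.

Lemma right_translationsP (s : 'S_n) :
  reflect (exists2 g, g \in G & forall i, phi (s i) = (phi i * g)%g)
          (s \in right_translations).
Proof.
rewrite inE; apply: (iffP exists_inP) => -[g Gg].
  by move/forallP=> sg; exists g => // i; apply/eqP.
by move=> sg; exists g => //; apply/forallP=> i; apply/eqP.
Qed.

Hypothesis phi_bij : basis_bij G phi.

Lemma basis_bij_mem (i : 'I_n) : phi i \in G.
Proof. by case: phi_bij => _ <-; apply: imset_f. Qed.

Lemma basis_bij_surj (x : gT) : x \in G -> exists i, phi i = x.
Proof. by case: phi_bij => _ <- /imsetP[i _ ->]; exists i. Qed.

(** The permutation is the conjugate of [f] by [phi]; it serves for both left and right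
    multiplications. *)
Lemma basis_bij_perm (f : gT -> gT) :
    injective f -> {in G, forall x, f x \in G} ->
  exists s : 'S_n, forall i, phi (s i) = f (phi i).
Proof.
move=> f_inj Gf; have [phi_inj _] := phi_bij.
have fP i : exists j, phi j == f (phi i).
  have [|j /eqP] := @basis_bij_surj (f (phi i)); last by exists j.
  exact/Gf/basis_bij_mem.
pose s i := xchoose (fP i).
have sE i : phi (s i) = f (phi i) by apply/eqP/(xchooseP (fP i)).
have s_inj : injective s.
  by move=> i j eq_s; apply/phi_inj/f_inj; rewrite -!sE eq_s.
by exists (perm s_inj) => i; rewrite permE.
Qed.

Lemma left_translation_ex (g : gT) :
  g \in G -> exists s : 'S_n, forall i, phi (s i) = (g * phi i)%g.
Proof.
by move=> Gg; apply: basis_bij_perm => [|x Gx]; [exact: mulgI | exact: groupM].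
Qed.

Lemma right_translation_ex (g : gT) :
  g \in G -> exists s : 'S_n, forall i, phi (s i) = (phi i * g)%g.
Proof.
by move=> Gg; apply: (@basis_bij_perm (mulg^~ g)) => [|x Gx];
  [exact: mulIg | exact: groupM].
Qed.

Lemma left_translations_group_set : group_set left_translations.
Proof.
apply/group_setP; split=> [|s t].
  by apply/left_translationsP; exists 1%g => // i; rewrite perm1 mul1g.
case/left_translationsP=> g Gg sg /left_translationsP[h Gh th].
apply/left_translationsP; exists (h * g)%g => [|i]; first exact: groupM.
by rewrite permM th sg mulgA.
Qed.

Definition left_translation_group := Group left_translations_group_set.

Lemma left_translations_trans :
  [transitive left_translation_group, on [set: 'I_n] | 'P].
Proof.
have [phi_inj _] := phi_bij; have [i0 _] := basis_bij_surj (group1 G).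
apply/imsetP; exists i0; rewrite ?inE //; apply/setP=> i.
rewrite inE; symmetry; apply/imsetP.
have Gg : (phi i * (phi i0)^-1)%g \in G.
  by rewrite groupM ?groupV ?basis_bij_mem.
have [s sE] := left_translation_ex Gg.
exists s; first by apply/left_translationsP; eexists; first exact: Gg.
by apply: phi_inj; rewrite /= /aperm sE mulgKV.
Qed.

(** Evaluation at the index [i1] of the identity recovers g from the translation by g, which yields
    an isomorphism from the translations onto [G]. *)
Lemma left_translations_isog : G \isog left_translation_group.
Proof.
have [phi_inj _] := phi_bij; have [i1 phi1] := basis_bij_surj (group1 G).
(* Permutations compose from left to right, hence the inverse. *)
pose f (s : 'S_n) := ((phi (s i1))^-1)%g.
have fM : {in left_translation_group &, {morph f : s t / (s * t)%g}}.
  move=> s t /left_translationsP[g Gg sg] /left_translationsP[h Gh th].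
  by rewrite /f permM th !sg th phi1 !mulg1 invMg.
rewrite isog_sym; apply/isogP; exists (Morphism fM).
  apply/injmP=> s t /left_translationsP[g Gg sg] /left_translationsP[h Gh th].
  rewrite /= /f sg th phi1 !mulg1 => /invg_inj eq_gh.
  by apply/permP=> i; apply: phi_inj; rewrite sg th eq_gh.
apply/setP=> x; apply/morphimP/idP => [[s _ _ ->] | Gx].
  by rewrite groupV basis_bij_mem.
have Gx' : (x^-1)%g \in G by rewrite groupV.
have [s sE] := left_translation_ex Gx'.
have Hs : s \in left_translation_group by apply/left_translationsP; exists x^-1%g.
by exists s; rewrite //= /f sE phi1 mulg1 invgK.
Qed.

(** If t commutes with the translation s by [phi i], which sends [i1] to [i], then [phi (t i)] is
    [phi (s (t i1))], that is, [phi i * phi (t i1)]. So t is the right translation by [phi (t i1)].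
    The converse is associativity. *)
Lemma cent_left_translations : 'C(left_translations) = right_translations.
Proof.
have [phi_inj _] := phi_bij; have [i1 phi1] := basis_bij_surj (group1 G).
apply/setP=> t; apply/centP/right_translationsP => [cHt | [g Gg tg] s].
  exists (phi (t i1)) => [|i]; first exact: basis_bij_mem.
  have [s sE] := left_translation_ex (basis_bij_mem i).
  have Hs : s \in left_translations.
    by apply/left_translationsP; exists (phi i); rewrite ?basis_bij_mem.
  have <- : s i1 = i by apply: phi_inj; rewrite sE phi1 mulg1.
  by rewrite -permM -(cHt s Hs) permM !sE phi1 mulg1.
case/left_translationsP=> h Gh sh; apply/permP=> i; apply: phi_inj.
by rewrite !permM sh !tg sh mulgA.
Qed.

End Translations.

(** * Ideals of the group algebra and stability under translations *)

Section Ideals.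

Variables (F : fieldType) (n : nat) (gT : finGroupType) (G : {group gT}).
Variables (phi : 'I_n -> gT) (C : {vspace 'rV[F]_n}).
Hypothesis phi_bij : basis_bij G phi.

Let rG := regular_repr F G.

Lemma lin_ext_is_linear : linear (@lin_ext F n gT G phi).
Proof.
move=> a u v; rewrite /lin_ext scaler_sumr -big_split /=.
by apply: eq_bigr => i _; rewrite !mxE scalerDl scalerA.
Qed.

HB.instance Definition _ :=
  GRing.isLinear.Build F 'rV[F]_n 'M[F]_#|G| *:%R (lin_ext G phi)
    lin_ext_is_linear.

(** The projection [gring_proj (phi j)] reads off the coordinate [j]. *)
Lemma lin_ext_inj : injective (@lin_ext F n gT G phi).
Proof.
have [phi_inj _] := phi_bij.
have coordE v j : gring_proj (phi j) (lin_ext G phi v) 0 0 = v 0 j.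
  rewrite linear_sum summxE (bigD1 j) //= big1 => [|i ne_ij].
    by rewrite linearZ mxE /= gring_projE ?(basis_bij_mem phi_bij) // eqxx
               addr0 mxE mulr1.
  rewrite linearZ mxE /= gring_projE ?(basis_bij_mem phi_bij) //.
  by rewrite (inj_eq phi_inj) eq_sym (negPf ne_ij) mxE mulr0.
by move=> u v eq_uv; apply/rowP=> j; rewrite -!coordE eq_uv.
Qed.

(** Both sides are linear in [v] and agree on the standard basis. Keeping [T] and [f] abstract
    covers left and right multiplication at once. *)
Lemma lin_ext_perm (s : 'S_n) (f : gT -> gT)
    (T : {linear 'M[F]_#|G| -> 'M[F]_#|G|}) (v : 'rV[F]_n) :
    {in G, forall x, T (rG x) = rG (f x)} ->
    (forall i, phi (s i) = f (phi i)) ->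
  lin_ext G phi (perm_lfun F s v) = T (lin_ext G phi v).
Proof.
move=> TrG sE; rewrite [v in LHS]row_sum_delta !linear_sum.
apply: eq_bigr => i _; rewrite !linearZ /= perm_lfun_delta lin_ext_delta sE.
by rewrite TrG ?(basis_bij_mem phi_bij).
Qed.

Lemma maps_onto_ex :
  exists2 I : 'A[F]_#|G|, (I <= group_ring F G)%MS & maps_onto phi C I.
Proof.
pose B := \matrix_(k < \dim C) mxvec (lin_ext G phi (vbasis C)`_k).
have BP A : (A \in B)%MS <-> exists2 v, v \in C & A = lin_ext G phi v.
  split=> [/submxP[d dE] | [v Cv ->]].
    exists (\sum_(k < \dim C) d 0 k *: (vbasis C)`_k).
      by rewrite memv_suml // => k _; rewrite memvZ // vbasis_mem ?mem_nth ?size_tuple.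
    apply: (can_inj mxvecK); rewrite dE mulmx_sum_row (linear_sum (lin_ext G phi)) linear_sum.
    by apply: eq_bigr => k _; rewrite rowK !linearZ.
  rewrite (coord_vbasis Cv) (linear_sum (lin_ext G phi)) linear_sum summx_sub // => k _.
  by rewrite !linearZ scalemx_sub // (eq_row_sub k) // rowK.
(* [<<B>>] has the row space of [B] and the square shape required of [I]. *)
exists <<B>>%MS => [|A]; last by rewrite genmxE.
rewrite genmxE; apply/row_subP=> k; rewrite rowK /lin_ext linear_sum.
rewrite summx_sub // => i _; rewrite linearZ scalemx_sub //.
exact/envelop_mx_id/(basis_bij_mem phi_bij).
Qed.

Section Stability.

Variable I : 'A[F]_#|G|.
Hypothesis phiI : maps_onto phi C I.

(** Since [lin_ext] intertwines [s] with [T], stability passes between [C] and its image;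
    injectivity of [lin_ext] brings it back to [C]. *)
Lemma PAut_stable (s : 'S_n) (f : gT -> gT)
    (T : {linear 'M[F]_#|G| -> 'M[F]_#|G|}) :
    {in G, forall x, T (rG x) = rG (f x)} ->
    (forall i, phi (s i) = f (phi i)) ->
  s \in PAut C <-> forall A, (A \in I -> T A \in I)%MS.
Proof.
move=> TrG sE; split=> [/PAutP sC _ /phiI[v Cv ->] | TI].
  by apply/phiI; exists (perm_lfun F s v); rewrite ?sC // (lin_ext_perm _ TrG sE).
apply/PAutP=> v Cv; have /TI/phiI[w Cw] : (lin_ext G phi v \in I)%MS.
  by apply/phiI; exists v.
by rewrite -(lin_ext_perm _ TrG sE) => /lin_ext_inj ->.
Qed.

(** The group ring is spanned by the matrices [rG g], so by linearity only multiplication by each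
    [rG g] has to be tested, and this corresponds to a single translation. *)
Lemma left_ideal_PAut :
  left_mx_ideal (group_ring F G) I <-> left_translations G phi \subset PAut C.
Proof.
have TrG g : g \in G -> {in G, forall x, mulmx (rG g) (rG x) = rG (g * x)%g}.
  by move=> Gg x Gx; rewrite repr_mxM.
split=> [/mulsmx_subP idI | /subsetP sC].
  apply/subsetP=> s /left_translationsP[g Gg sg].
  apply/(PAut_stable (TrG g Gg) sg) => A IA.
  by apply: idI => //; apply: envelop_mx_id.
apply/mulsmx_subP=> _ A /envelop_mxP[a ->] IA.
rewrite mulmx_suml linear_sum summx_sub // => g Gg.
rewrite -scalemxAl linearZ scalemx_sub //.
have [s sg] := left_translation_ex phi_bij Gg.
apply: (iffLR (PAut_stable (TrG g Gg) sg)) IA.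
by apply: sC; apply/left_translationsP; exists g.
Qed.

Lemma right_ideal_PAut :
  right_mx_ideal (group_ring F G) I <-> right_translations G phi \subset PAut C.
Proof.
have TrG g : g \in G -> {in G, forall x, mulmxr (rG g) (rG x) = rG (x * g)%g}.
  by move=> Gg x Gx; rewrite repr_mxM.
split=> [/mulsmx_subP idI | /subsetP sC].
  apply/subsetP=> s /right_translationsP[g Gg sg].
  apply/(PAut_stable (TrG g Gg) sg) => A IA.
  by apply: idI => //; apply: envelop_mx_id.
apply/mulsmx_subP=> A _ IA /envelop_mxP[a ->].
rewrite mulmx_sumr linear_sum summx_sub // => g Gg.
rewrite -scalemxAr linearZ scalemx_sub //.
have [s sg] := right_translation_ex phi_bij Gg.
apply: (iffLR (PAut_stable (TrG g Gg) sg)) IA.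
by apply: sC; apply/right_translationsP; exists g.
Qed.

End Stability.

End Ideals.

(** * Group codes restated through translations alone *)

Lemma left_group_codeP (F : fieldType) (n : nat) (C : {vspace 'rV[F]_n})
    (gT : finGroupType) (G : {group gT}) :
  left_group_code G C <->
  exists2 phi, basis_bij G phi & left_translations G phi \subset PAut C.
Proof.
split=> [[phi [phiB [I [_ idI phiI]]]] | [phi phiB sC]]; exists phi => //.
  exact/(left_ideal_PAut phiB phiI).
(* The image of [C] always is the row space of some [I]; [sC] makes it an ideal. *)
split=> //; have [I sI phiI] := maps_onto_ex C phiB; exists I.
by split=> //; apply/(left_ideal_PAut phiB phiI).
Qed.

Lemma group_codeP (F : fieldType) (n : nat) (C : {vspace 'rV[F]_n})
    (gT : finGroupType) (G : {group gT}) :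
  group_code G C <->
  exists2 phi, basis_bij G phi &
    left_translations G phi :|: right_translations G phi \subset PAut C.
Proof.
split=> [[phi [phiB [I [_ /andP[lI rI] phiI]]]] | [phi phiB]].
  exists phi => //; rewrite subUset; apply/andP; split.
    exact/(left_ideal_PAut phiB phiI).
  exact/(right_ideal_PAut phiB phiI).
rewrite subUset => /andP[lC rC]; exists phi; split=> //.
have [I sI phiI] := maps_onto_ex C phiB; exists I; split=> //.
apply/andP; split; first exact/(left_ideal_PAut phiB phiI).
exact/(right_ideal_PAut phiB phiI).
Qed.

(** * Transitive subgroups of order n as left translations *)

Lemma transitive_left_translations (n : nat) (gT : finGroupType)
    (G : {group gT}) (H : {group 'S_n}) :
    #|G| = n -> G \isog H -> [transitive H, on [set: 'I_n] | 'P] ->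
  exists2 phi, basis_bij G phi & left_translations G phi = H.
Proof.
move=> oG /isogP[f _ fG] trH.
have n_gt0 : (0 < n)%N by rewrite -oG cardG_gt0.
pose i0 := Ordinal n_gt0.
(* By transitivity the orbit map sending g to [f g i0] is onto; [psi] is a section of it. *)
have orbP i : exists g, (g \in G) && (f g i0 == i).
  have [s Hs ->] := atransP2 trH (in_setT i0) (in_setT i).
  move: Hs; rewrite -fG => /morphimP[g Gg _ ->].
  by exists g; rewrite Gg /=.
pose psi i := xchoose (orbP i).
have Gpsi i : psi i \in G by case/andP: (xchooseP (orbP i)).
have fpsi i : f (psi i) i0 = i by case/andP: (xchooseP (orbP i)) => _ /eqP.
have psi_inj : injective psi by move=> i j eq_ij; rewrite -(fpsi i) eq_ij.
(* Here [oG] makes the section a bijection, hence the inverse of the orbit map: the action is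
   regular. *)
have psiG : [set psi i | i : 'I_n] = G.
  apply/eqP; rewrite eqEcard card_imset // card_ord oG leqnn andbT.
  by apply/subsetP=> _ /imsetP[i _ ->].
have psiK g : g \in G -> psi (f g i0) = g.
  by rewrite -{1}psiG => /imsetP[i _ ->]; rewrite fpsi.
have psiM g i : g \in G -> psi (f g i) = (psi i * g)%g.
  move=> Gg; rewrite -{1}(fpsi i) -permM -morphM ?Gpsi //.
  by rewrite psiK // groupM ?Gpsi.
(* Through [psi], [f g] acts as right multiplication by g, as permutations compose from left to
   right; inverting turns this into left multiplication by the inverse of g. *)
pose phi i := ((psi i)^-1)%g.
have phi_inj : injective phi by move=> i j /invg_inj/psi_inj.
have phiB : basis_bij G phi.
  split=> //; apply/eqP; rewrite eqEcard card_imset // card_ord oG leqnn andbT.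
  by apply/subsetP=> _ /imsetP[i _ ->]; rewrite groupV.
have phiM g i : g \in G -> phi (f g i) = (g^-1 * phi i)%g.
  by move=> Gg; rewrite /phi psiM // invMg.
exists phi => //; apply/setP=> s; rewrite -fG.
apply/left_translationsP/morphimP => [[g Gg sg] | [g Gg _ ->]].
  exists (g^-1)%g; rewrite ?groupV //; apply/permP=> i; apply: phi_inj.
  by rewrite sg phiM ?groupV // invgK.
by exists (g^-1)%g => [|i]; rewrite ?groupV ?phiM.
Qed.

Theorem theorem1p2 (F : fieldType) (n : nat) (C : {vspace 'rV[F]_n})
    (gT : finGroupType) (G : {group gT}) (oG : #|G| = n) :
  (left_group_code G C <->
     exists H : {group 'S_n},
       [/\ G \isog H, [transitive H, on [set: 'I_n] | 'P] & H \subset PAut C])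
  /\
  (group_code G C <->
     exists H : {group 'S_n},
       [/\ G \isog H, [transitive H, on [set: 'I_n] | 'P]
         & H :|: 'C(H) \subset PAut C]).
Proof.
split.
  split=> [/left_group_codeP[phi phiB sC] | [H [isoH trH sC]]].
    exists (left_translation_group G phi); split=> //.
      exact: left_translations_isog.
    exact: left_translations_trans.
  have [phi phiB eqH] := transitive_left_translations oG isoH trH.
  by apply/left_group_codeP; exists phi; rewrite ?eqH.
split=> [/group_codeP[phi phiB sC] | [H [isoH trH sC]]].
  exists (left_translation_group G phi); split.
  - exact: left_translations_isog.
  - exact: left_translations_trans.
  (* The centralizer consists of the right translations, so the inclusion is [sC]. *)
  - by rewrite /= cent_left_translations.
have [phi phiB eqH] := transitive_left_translations oG isoH trH.
by apply/group_codeP; exists phi; rewrite // -cent_left_translations // eqH.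
Qed.
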